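(* Let $G_a$ be a symmetric positive definite weighted graph and let $N\ge 2$. Then for an arbitrarily chosen nonempty boundary $G_B$ (a set of vertices of $G_a$), there is more than one scheme to partition $G_a$ by Electric Vertex Splitting with boundary $G_B$ into $N$ subgraphs $\tilde G_1,\dots,\tilde G_N$ such that every $\tilde G_j$, $j=1,\dots,N$, is symmetric positive definite.
   Context: **Weighted graph.** A symmetric real $n\times n$ matrix $A=(a_{il})$ is identified with its weighted graph $G_a$: the vertices are $1,\dots,n$, there is an edge between $i\ne l$ iff $a_{il}\neq0$, vertex $i$ has weight $a_{ii}$ and edge $\{i,l\}$ has weight $a_{il}$. $G_a$ is called symmetric positive definite (SPD) iff $A$ is SPD. **Electric Vertex Splitting (EVS) of a weighted graph.** A set $G_B$ of vertices, the boundary, is chosen; vertices not in $G_B$ are called inner. Each boundary vertex is split into copies lying in different subgraphs (a pair of twin vertices in a single splitting; copies may be split again, which is called multilevel splitting). The weight of each boundary vertex, and the weight of each edge joining two boundary vertices, is split among the copies; inner vertices and edges incident to inner vertices are not split. Explicitly, an EVS partition scheme of $G_a$ with boundary $G_B$ into $N$ subgraphs $\tilde G_1,\dots,\tilde G_N$ consists of: - nonempty sets $V_1,\dots,V_N\subseteq\{1,\dots,n\}$ with union $\{1,\dots,n\}$ such that each inner vertex lies in exactly one $V_j$ and each boundary vertex lies in at least two of the $V_j$ (exactly two in a single splitting); - symmetric real matrices $\tilde A_j$ indexed by $V_j$, with $(\tilde A_j)_{il}=0$ whenever $i\ne l$ and $a_{il}=0$, such that after extension by zero to $\{1,\dots,n\}$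 one has $\sum_{j=1}^N\tilde A_j=A$. The subgraph $\tilde G_j$ is the weighted graph of $\tilde A_j$; it is called SPD iff $\tilde A_j$ is SPD. *)

(* Defs.v *)
From HB Require Import structures.
From mathcomp Require Import all_boot all_order all_algebra.
From mathcomp Require Import reals.
Set Implicit Arguments.
Unset Strict Implicit.
Unset Printing Implicit Defensive.
Import Order.TTheory GRing.Theory Num.Theory.
Local Open Scope ring_scope.

Definition spd (R : realType) (n : nat) (A : 'M[R]_n) : Prop :=
  A^T = A /\ forall x : 'cV[R]_n, x != 0 -> 0 < (x^T *m A *m x) 0 0.

(* A symmetric matrix is identified with its weighted graph. *)
Definition edge (R : realType) (n : nat) (A : 'M[R]_n) (i l : 'I_n) : bool :=
  (i != l) && (A i l != 0).

(* A vertex set V together with a matrix indexed by V: the row and column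
   p : 'I_#|V| stand for the vertex enum_val p. *)
Record subgraph (R : realType) (n : nat) := Subgraph {
  verts : {set 'I_n};
  wmx : 'M[R]_#|verts|
}.

(* Extension by zero: each double sum has one term if i and l both lie in
   verts G, and none otherwise. *)
Definition extend0 (R : realType) (n : nat) (G : subgraph R n) : 'M[R]_n :=
  \matrix_(i, l)
    \sum_(p < #|verts G| | enum_val p == i)
      \sum_(q < #|verts G| | enum_val q == l) wmx G p q.

(* Inner vertices, and hence the edges incident to them, are not split because
   an inner vertex lies in a single vertex set.  A boundary vertex may have more
   than two copies (multilevel splitting). *)
Record is_EVS (R : realType) (n N : nat) (A : 'M[R]_n) (B : {set 'I_n})
    (S : {ffun 'I_N -> subgraph R n}) : Prop := IsEVS {
  evs_nonempty : forall j, verts (S j) != set0;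
  evs_cover : \bigcup_j verts (S j) = [set: 'I_n];
  evs_inner : forall i, i \notin B -> #|[set j | i \in verts (S j)]| = 1%N;
  evs_boundary : forall i, i \in B -> (2 <= #|[set j | i \in verts (S j)]|)%N;
  evs_sym : forall j, (wmx (S j))^T = wmx (S j);
  evs_edges : forall j (p q : 'I_#|verts (S j)|),
    p != q -> ~~ edge A (enum_val p) (enum_val q) -> wmx (S j) p q = 0;
  evs_sum : \sum_j extend0 (S j) = A
}.

(* Main.v *)
(* Put every vertex into the first subgraph and exactly the boundary vertices
   into each of the other N - 1; give the latter the matrix t I and the former
   what remains, A - (N - 1) t 1_B.  This remainder is SPD for all small t > 0
   because an SPD matrix A dominates c I for some c > 0, and distinct values of
   t give distinct schemes. *)
Require Import Defs.
From mathcomp Require Import all_boot all_order all_algebra.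
From mathcomp Require Import reals.
From mathcomp Require Import ring lra.
Set Implicit Arguments.
Unset Strict Implicit.
Unset Printing Implicit Defensive.
Import Order.TTheory GRing.Theory Num.Theory.
Local Open Scope ring_scope.

(** A row vector [v] with [v *m A = 0] makes the quadratic form of [A] vanish at [v^T], so
    positivity forces [v = 0]. *)
Lemma spd_unitmx (R : realType) (n : nat) (A : 'M[R]_n) :
  spd A -> A \in unitmx.
Proof.
move=> [_ A_pos]; rewrite -row_free_unit -kermx_eq0.
apply/eqP/row_matrixP => i; rewrite row0.
have /sub_kermxP vA0 : (row i (kermx A) <= kermx A)%MS by exact: row_sub.
have [//|v_neq0] := eqVneq (row i (kermx A)) 0.
have /A_pos : (row i (kermx A))^T != 0 by rewrite trmx_eq0.
by rewrite trmxK vA0 mul0mx mxE ltxx.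
Qed.

Lemma spd_ge0 (R : realType) (n : nat) (A : 'M[R]_n) (x : 'cV[R]_n) :
  spd A -> 0 <= (x^T *m A *m x) 0 0.
Proof.
move=> [_ A_pos]; have [->|/A_pos /ltW //] := eqVneq x 0.
by rewrite mulmx0 mxE.
Qed.

(* Cauchy-Schwarz for the inner product of A, applied to x and A^-1 e_i; the
   term 1 only serves to keep the divisor away from 0. *)
Lemma spd_coord_le (R : realType) (n : nat) (A : 'M[R]_n) (x : 'cV[R]_n)
    (i : 'I_n) : spd A ->
  x i 0 ^+ 2 <= (1 + invmx A i i) * (x^T *m A *m x) 0 0.
Proof.
move=> A_spd; have A_unit := spd_unitmx A_spd; have [A_sym _] := A_spd.
pose y : 'cV[R]_n := invmx A *m delta_mx i 0.
have Ay : A *m y = delta_mx i 0 by rewrite mulKVmx.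
have yA : y^T *m A = delta_mx 0 i.
  by rewrite -[in LHS]A_sym -trmx_mul Ay trmx_delta.
have form_xy (z : 'cV[R]_n) : (z^T *m A *m y) 0 0 = z i 0.
  by rewrite -mulmxA Ay -colE !mxE.
have form_yx (z : 'cV[R]_n) : (y^T *m A *m z) 0 0 = z i 0.
  by rewrite yA -rowE mxE.
have yi : y i 0 = invmx A i i by rewrite /y -colE mxE.
have m_ge0 : 0 <= invmx A i i by rewrite -yi -(form_xy y) spd_ge0.
have expand s : ((x - s *: y)^T *m A *m (x - s *: y)) 0 0 =
    (x^T *m A *m x) 0 0 - 2 * s * x i 0 + s ^+ 2 * invmx A i i.
  rewrite [(x - _)^T]linearB linearZ /= !mulmxBl !mulmxBr -!scalemxAl -!scalemxAr.
  move: (form_xy x) (form_yx x) (form_yx y); rewrite yi.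
  move: (x^T *m A *m x) (x^T *m A *m y) (y^T *m A *m x) (y^T *m A *m y).
  by move=> xx xy yx yy xyE yxE yyE; rewrite !mxE xyE yxE yyE; ring.
have := spd_ge0 (x - (x i 0 / (1 + invmx A i i)) *: y) A_spd.
rewrite expand; move: (x i 0) ((x^T *m A *m x) 0 0) (invmx A i i) m_ge0.
move=> u q m m_ge0 le_q.
have m1_gt0 : 0 < 1 + m by rewrite ltr_wpDr.
set s := u / (1 + m) in le_q.
have u_eq : u = s * (1 + m) by rewrite /s divfK ?gt_eqF.
rewrite u_eq in le_q *.
have s2_ge0 : 0 <= s ^+ 2 by exact: sqr_ge0.
(* Substituting [u = s * (1 + m)] turns the hypothesis into [0 <= q - s ^+ 2 * (2 + m)]. Multiplying
   the resulting bound by [1 + m] then gives [u ^+ 2 <= (1 + m) * q]. *)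
have : s ^+ 2 * (1 + m) <= q by nra.
rewrite -(ler_pM2l m1_gt0); apply: le_trans.
by rewrite le_eqVlt; apply/orP; left; apply/eqP; ring.
Qed.

(** Summing the coordinate bounds gives an explicit constant, without eigenvalues or compactness. *)
Lemma spd_coercive (R : realType) (n : nat) (A : 'M[R]_n) : spd A ->
  exists2 c : R, 0 < c &
    forall x : 'cV[R]_n, c * \sum_i x i 0 ^+ 2 <= (x^T *m A *m x) 0 0.
Proof.
move=> A_spd; pose k := \sum_i (1 + invmx A i i).
have k_ge (x : 'cV[R]_n) : \sum_i x i 0 ^+ 2 <= k * (x^T *m A *m x) 0 0.
  by rewrite mulr_suml; apply: ler_sum => i _; exact: spd_coord_le.
(* [k] is an empty sum when [n = 0]; [1 + |k|] bounds it from above and is positive in every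
   case. *)
have k1_gt0 : 0 < 1 + `|k| by rewrite ltr_wpDr.
exists (1 + `|k|)^-1 => [|x]; first by rewrite invr_gt0.
rewrite ler_pdivrMl //; apply: le_trans (k_ge x) _.
by rewrite ler_wpM2r ?spd_ge0 // (le_trans (ler_norm k)) // lerDr.
Qed.

Lemma spd_sub_diag (R : realType) (n : nat) (A : 'M[R]_n) : spd A ->
  exists2 c : R, 0 < c &
    forall d : 'rV[R]_n, (forall i, d 0 i < c) -> spd (A - diag_mx d).
Proof.
move=> A_spd; have [c c_gt0 c_le] := spd_coercive A_spd.
exists c => // d d_lt; split.
  by rewrite linearB /= tr_diag_mx; have [-> _] := A_spd.
move=> x x_neq0; rewrite mulmxBr mulmxBl mxE [X in _ + X]mxE subr_gt0.
apply: lt_le_trans (c_le x); rewrite mxE.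
have -> : \sum_j (x^T *m diag_mx d) 0 j * x j 0 = \sum_j d 0 j * x j 0 ^+ 2.
  by apply: eq_bigr => j _; rewrite mul_mx_diag !mxE; ring.
(* A nonzero coordinate makes one term of the comparison strict; the others need only [<=]. *)
have [i xi_neq0] : exists i, x i 0 != 0.
  apply/existsP; apply: contraR x_neq0 => /existsPn x0.
  by apply/eqP/colP => i; rewrite mxE; apply/eqP; have := x0 i; rewrite negbK.
rewrite mulr_sumr (bigD1 i) //= [ltRHS](bigD1 i) //= ltr_leD //.
  by rewrite ltr_pM2r ?d_lt // exprn_even_gt0.
by apply: ler_sum => j _; rewrite ler_wpM2r ?sqr_ge0 // ltW.
Qed.

Lemma spd_scalar (R : realType) (n : nat) (t : R) :
  0 < t -> spd (t%:M : 'M[R]_n).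
Proof.
move=> t_gt0; split=> [|x x_neq0]; first exact: tr_scalar_mx.
rewrite mul_mx_scalar -scalemxAl mxE pmulr_rgt0 // mxE.
have sq_ge0 j : true -> 0 <= x^T 0 j * x j 0.
  by rewrite mxE -expr2 sqr_ge0.
rewrite lt_def sumr_ge0 // andbT psumr_eq0 //.
apply: contra x_neq0 => /allP x0; apply/eqP/colP => j.
have /implyP/(_ isT) := x0 j (mem_index_enum j).
by rewrite !mxE mulf_eq0 orbb => /eqP.
Qed.

Lemma spd_mxsub (R : realType) (m n : nat) (f : 'I_m -> 'I_n) (A : 'M[R]_n) :
  injective f -> spd A -> spd (mxsub f f A).
Proof.
move=> f_inj [A_sym A_pos].
split=> [|x x_neq0]; first by rewrite trmx_mxsub A_sym.
(* [P^T] extends a vector by zero along [f]. The form of the submatrix at [x] is that of [A] at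
   [P^T *m x], which is nonzero because [P *m P^T = 1]. *)
pose P : 'M[R]_(m, n) := rowsub f 1%:M.
have PPt : P *m P^T = 1%:M.
  by apply/matrixP => p q; rewrite mul_rowsub_mx mul1mx !mxE eq_sym (inj_eq f_inj).
have -> : mxsub f f A = P *m A *m P^T.
  rewrite -rowsubE trmx_mxsub trmx1 mulmx_colsub mulmx1.
  by apply/matrixP => p q; rewrite !mxE.
have -> : x^T *m (P *m A *m P^T) *m x = (P^T *m x)^T *m A *m (P^T *m x).
  by rewrite trmx_mul trmxK !mulmxA.
apply: A_pos; apply: contra x_neq0 => /eqP Px0.
by rewrite -[x]mul1mx -PPt -mulmxA Px0 mulmx0.
Qed.

(** Cutting each piece out of a full matrix keeps the indices ['I_#|V|] out of most later
    arguments. *)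
Definition induced (R : realType) (n : nat) (V : {set 'I_n}) (A : 'M[R]_n) :
  subgraph R n := Subgraph (mxsub (@enum_val _ (mem V)) (@enum_val _ (mem V)) A).

Lemma extend0_induced (R : realType) (n : nat) (V : {set 'I_n}) (A : 'M[R]_n)
    (i l : 'I_n) :
  extend0 (induced V A) i l = A i l *+ ((i \in V) && (l \in V)).
Proof.
rewrite mxE /=.
under eq_bigr => p _ do under eq_bigr => q _ do rewrite mxE.
under eq_bigr => p _ do
  rewrite -(big_enum_val_cond (A := mem V) (pred1 l) (fun y => A (enum_val p) y)).
rewrite -(big_enum_val_cond (A := mem V) (pred1 i)
            (fun x => \sum_(y in V | y == l) A x y)) /=.
rewrite big_mkcondl /= big_pred1_eq; case: (i \in V) => //=.
by rewrite big_mkcondl /= big_pred1_eq; case: (l \in V).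
Qed.

Definition boundary_diag (R : realType) (n : nat) (B : {set 'I_n}) (t : R) :
  'rV[R]_n := \row_i (t *+ (i \in B)).

(** The type ['I_N.+2] builds in at least two subgraphs: index 0 is the large one, and [N.+1] others
    remain. *)
Definition star_verts (n N : nat) (B : {set 'I_n}) (j : 'I_N.+2) : {set 'I_n} :=
  if j == 0 then [set: 'I_n] else B.

Definition star_scheme (R : realType) (n N : nat) (A : 'M[R]_n)
    (B : {set 'I_n}) (t : R) : {ffun 'I_N.+2 -> subgraph R n} :=
  [ffun j => induced (star_verts B j)
    (if j == 0 then A - diag_mx (boundary_diag B (t *+ N.+1)) else t%:M)].

Lemma star_scheme_EVS (R : realType) (n N : nat) (A : 'M[R]_n)
    (B : {set 'I_n}) (t : R) :
  A^T = A -> B != set0 -> is_EVS A B (star_scheme N A B t).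
Proof.
move=> A_sym B_neq0.
have vertsE j : verts (star_scheme N A B t j) = star_verts B j by rewrite ffunE.
split.
- move=> j; rewrite vertsE /star_verts; case: ifP => // _.
  by case/set0Pn: B_neq0 => i _; apply/set0Pn; exists i; rewrite inE.
- apply/setP => i; rewrite inE; apply/bigcupP; exists 0 => //.
  by rewrite vertsE inE.
- move=> i iNB; rewrite -(cards1 (0 : 'I_N.+2)); congr #|pred_of_set _|.
  apply/setP => j; rewrite !inE vertsE /star_verts.
  by case: ifP => _; rewrite ?inE // (negbTE iNB).
- move=> i iB; rewrite (_ : [set j | _] = setT) ?cardsT ?card_ord //.
  by apply/setP => j; rewrite !inE vertsE /star_verts; case: ifP; rewrite ?inE.
- move=> j; rewrite ffunE /= trmx_mxsub; congr mxsub.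
  by case: ifP => _; rewrite ?tr_scalar_mx // linearB /= tr_diag_mx A_sym.
- move=> j; rewrite ffunE /= => p q p_neq_q.
  have ep_neq_eq : enum_val p != enum_val q by rewrite (inj_eq enum_val_inj).
  rewrite /edge ep_neq_eq /= negbK mxE => /eqP Apq0.
  by case: ifP => _; rewrite !mxE ?Apq0 (negbTE ep_neq_eq) // subrr.
apply/matrixP => i l; rewrite summxE big_ord_recl.
rewrite !ffunE extend0_induced /star_verts eqxx !inE mulr1n.
under eq_bigr => j _ do
  rewrite ffunE extend0_induced /star_verts eq_sym (negbTE (neq_lift _ _)).
rewrite sumr_const card_ord !mxE.
(* Off the diagonal only [A] contributes. On it, at a boundary vertex, the [N.+1] small pieces give
   back the [t *+ N.+1] taken from the large one. *)
have [->|_] := eqVneq i l; last by rewrite !mulr0n mul0rn subr0 mul0rn addr0.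
by rewrite andbb !mulr1n mulrnAC subrK.
Qed.

(** The value [t] is read off piece 1 at a boundary vertex. Passing through [extend0] avoids
    comparing matrices whose type depends on the vertex set. *)
Lemma star_scheme_inj (R : realType) (n N : nat) (A : 'M[R]_n) (B : {set 'I_n}) :
  B != set0 -> injective (star_scheme N A B).
Proof.
move=> /set0Pn[b bB] s t /ffunP/(_ (lift 0 0)).
move=> /(congr1 (fun G => extend0 G b b)).
by rewrite !ffunE !extend0_induced /= /star_verts /= bB !mxE eqxx.
Qed.

Lemma star_scheme_spd (R : realType) (n N : nat) (A : 'M[R]_n)
    (B : {set 'I_n}) : spd A ->
  exists2 c : R, 0 < c & forall t, 0 < t < c ->
    forall j, spd (wmx (star_scheme N A B t j)).
Proof.
move=> A_spd; have [c c_gt0 c_spd] := spd_sub_diag A_spd.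
(* The large piece loses [t *+ N.+1] at each boundary vertex, and this must stay below [c]. *)
exists (c / N.+1%:R) => [|t /andP[t_gt0 t_lt] j]; first by rewrite divr_gt0.
rewrite ffunE /=; apply: spd_mxsub; first exact: enum_val_inj.
case: ifP => _; last exact: spd_scalar.
apply: c_spd => i; rewrite mxE; case: (i \in B); last by rewrite mulr0n.
by rewrite mulr1n -mulr_natr -ltr_pdivlMr.
Qed.

Theorem theorem4p2 (R : realType) (n N : nat) (A : 'M[R]_n) (B : {set 'I_n})
    (A_spd : spd A) (N_ge2 : (2 <= N)%N) (B_neq0 : B != set0) :
  exists S1 S2 : {ffun 'I_N -> subgraph R n},
    [/\ S1 <> S2,
        is_EVS A B S1 /\ (forall j, spd (wmx (S1 j))) &
        is_EVS A B S2 /\ (forall j, spd (wmx (S2 j)))].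
Proof.
case: N N_ge2 => [|[|N]] // _.
have [c c_gt0 c_spd] := star_scheme_spd N B A_spd.
(* Any two distinct values strictly between 0 and [c] would serve. *)
have c2_neq_c3 : c / 2 <> c / 3 by lra.
have c2_bnd : 0 < c / 2 < c by lra.
have c3_bnd : 0 < c / 3 < c by lra.
have [A_sym _] := A_spd.
exists (star_scheme N A B (c / 2)), (star_scheme N A B (c / 3)).
split; first by move/(star_scheme_inj B_neq0).
  by split; [exact: star_scheme_EVS | exact: c_spd].
by split; [exact: star_scheme_EVS | exact: c_spd].
Qed.
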